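(* Let $A$ and $B$ be positive-definite self-adjoint operators in a separable complex Hilbert space $\mathfrak{H}$ with $\mathcal{D}(A)=\mathcal{D}(B)$, where $A$ has discrete spectrum and $B$ has discrete simple spectrum $\lambda_1<\lambda_2<\cdots$ and an orthonormal basis of eigenvectors $\{e_k\}_{k=1}^\infty$, $Be_k=\lambda_ke_k$. Let $\omega:[0,\infty)\to\mathbb{R}$ satisfy: 1) $\omega$ is continuous and nondecreasing on $[0,\infty)$; 2) $\omega(0)=0$; 3) there exists $c'>0$ such that $\omega(2t)\le c'\omega(t)$ for all $t>0$; 4) $\int_0^1\frac{\omega(t)}{t}\,dt<\infty$. Let $x\in\mathcal{D}(B)$ be the solution of $Ax=y$ with $y\in\mathfrak{H}$, let $x_n$ be its Ritz approximate solution with respect to the coordinate system $\{e_k\}_{k=1}^\infty$, and let $\alpha>1$. If there is a constant $c$ such that for all $n\in\mathbb{N}$ $$\|x-x_n\|_+\le\frac{c}{\lambda_{n+1}^{\alpha-\frac12}}\,\omega\left(\frac{1}{\lambda_{n+1}}\right),$$ then $x\in\mathcal{D}(B^\alpha)$.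
   Context: Positive definite means $(Az,z)\ge\gamma\|z\|^2$ on $\mathcal{D}(A)$ for some $\gamma>0$ (similarly for $B$). Discrete spectrum means that the spectrum consists of isolated eigenvalues of finite multiplicity. The energy norm is $\|z\|_+=(Az,z)^{1/2}$ for $z\in\mathcal{D}(A)$ (that is, $\|z\|_+=\|A^{1/2}z\|$). Ritz approximate solution: $x_n$ is the vector at which the functional $F(z)=(Az,z)-2\,\mathrm{Re}\,(y,z)$ attains its minimum on $\mathcal{H}_n=\mathrm{span}\{e_1,\dots,e_n\}$. *)

(* Defs.v *)
From HB Require Import structures.
From mathcomp Require Import all_boot all_order all_algebra.
From mathcomp Require Import all_classical all_reals all_analysis.
From mathcomp Require Import complex.

Set Implicit Arguments.
Unset Strict Implicit.
Unset Printing Implicit Defensive.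

Import Order.TTheory GRing.Theory Num.Theory.
Import numFieldNormedType.Exports.

Local Open Scope classical_set_scope.
Local Open Scope ring_scope.
Local Open Scope complex_scope.

Definition separable_space (T : topologicalType) : Prop :=
  exists2 S : set T, countable S & dense S.

(* An operator H -> H defined on the set [dom]; the values of [app] outside
   [dom] are junk and never used. *)
Record operator (H : Type) := Operator { dom : set H ; app :> H -> H }.

Section Hilbert.
Context {R : realType} {H : completeNormedModType R[i]}.

(* A dot product is linear in its first argument and conjugate-linear in the
   second.  When its norm is that of the complete normed space H, H is a
   Hilbert space. *)
Definition is_inner_product_of_norm (ip : {dot H for @Num.conj R[i]}) : Prop :=
  forall z : H, `|z| ^+ 2 = ip z z.

Variable ip : {dot H for @Num.conj R[i]}.
Implicit Types A B : operator H.

Definition linear_operator A : Prop :=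
  [/\ dom A 0,
      forall (a : R[i]) u v, dom A u -> dom A v -> dom A (a *: u + v) &
      forall (a : R[i]) u v, dom A u -> dom A v ->
        A (a *: u + v) = a *: A u + A v].

(* Graph of the adjoint; single-valued when [dom A] is dense. *)
Definition adjoint_graph A (v w : H) : Prop :=
  forall u, dom A u -> ip (A u) v = ip u w.

Definition self_adjoint A : Prop :=
  [/\ linear_operator A, dense (dom A) &
      forall v w, dom A v /\ A v = w <-> adjoint_graph A v w].

(* The order of R[i] compares only numbers with equal imaginary parts, so the
   inequality includes that (Az, z) is real. *)
Definition positive_definite A : Prop :=
  exists2 gamma : R, 0 < gamma &
    forall z, dom A z -> gamma%:C * `|z| ^+ 2 <= ip (A z) z.

Definition resolvent_set A : set R[i] := [set z |
  (forall w, exists! u, dom A u /\ A u - z *: u = w) /\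
  (exists M : R, forall u, dom A u -> `|u| <= M%:C * `|A u - z *: u|)].

Definition spectrum A : set R[i] := ~` resolvent_set A.

Definition eigenspace A (z : R[i]) : set H :=
  [set u | dom A u /\ A u = z *: u].

Definition eigenvalue A (z : R[i]) : Prop :=
  exists2 u, u != 0 & eigenspace A z u.

(* Only used for self-adjoint operators, for which algebraic and geometric
   multiplicities coincide. *)
Definition finite_multiplicity A (z : R[i]) : Prop :=
  exists n (v : 'I_n -> H), forall u, eigenspace A z u ->
    exists a : 'I_n -> R[i], u = \sum_(i < n) a i *: v i.

Definition multiplicity_one A (z : R[i]) : Prop :=
  exists2 v : H, v != 0 & eigenspace A z = range (fun a : R[i] => a *: v).

Definition discrete_spectrum A : Prop :=
  forall z, spectrum A z ->
    [/\ isolated (spectrum A : set R[i]^o) z, eigenvalue A z & finite_multiplicity A z].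

Definition simple_spectrum A : Prop :=
  forall z, spectrum A z -> multiplicity_one A z.

Definition orthonormal_basis (e : nat -> H) : Prop :=
  (forall j k, ip (e j) (e k) = (j == k)%:R) /\
  (forall z, series (fun k => ip z (e k) *: e k) @ \oo --> z).

(* Indices start at 0: [lam k] and [e k] are the mathematical lambda_(k+1) and
   e_(k+1). *)
Definition eigenbasis B (lam : nat -> R) (e : nat -> H) : Prop :=
  orthonormal_basis e /\ forall k, dom B (e k) /\ B (e k) = (lam k)%:C *: e k.

(* B^alpha, for B self-adjoint and positive definite with eigenbasis lam, e, as
   given by the functional calculus: B^alpha z = sum_k lam_k^alpha (z, e_k) e_k,
   on those z for which sum_k lam_k^(2 alpha) |(z, e_k)|^2 is finite. *)
Definition eigen_power (lam : nat -> R) (e : nat -> H) (alpha : R) :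
    operator H :=
  Operator
    [set z | cvgn (series (fun k =>
       lam k `^ (2 * alpha) * (complex.Re `|ip z (e k)|) ^+ 2 : R))]
    (fun z => limn (series (fun k =>
       ((lam k `^ alpha)%:C * ip z (e k)) *: e k))).

Definition energy_norm A (z : H) : R := Num.sqrt (complex.Re (ip (A z) z)).

Definition first_span (e : nat -> H) (n : nat) : set H :=
  [set z | exists a : 'I_n -> R[i], z = \sum_(i < n) a i *: e i].

(* For symmetric A the number (Az, z) is real, so taking its real part changes
   only its type. *)
Definition ritz_functional A (y z : H) : R :=
  complex.Re (ip (A z) z) - 2 * complex.Re (ip y z).

Definition ritz_approximation A (y : H) (e : nat -> H) (n : nat) (xn : H) :
    Prop :=
  first_span e n xn /\
  forall z, first_span e n z -> ritz_functional A y xn <= ritz_functional A y z.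

End Hilbert.

(* Main.v *)
Require Import Defs.
From HB Require Import structures.
From mathcomp Require Import all_boot all_order all_algebra.
From mathcomp Require Import all_classical all_reals all_analysis.
From mathcomp Require Import complex.
From mathcomp Require Import measurable_realfun ring lra.
Set Implicit Arguments.
Unset Strict Implicit.
Unset Printing Implicit Defensive.
Import Order.TTheory GRing.Theory Num.Theory.
Import numFieldNormedType.Exports.
Local Open Scope classical_set_scope.
Local Open Scope ring_scope.
Local Open Scope complex_scope.

(** Since [dom A = dom B], the energy norms of [A] and [B] are comparable:
    [(Bz, z) <= M (Az, z)] on the common domain.  Granting this, apply it to
    [z = x - x_n].  The vectors [x] and [x - x_n] have the same coefficients
    along [e k] for [k >= n], so, with [a k = |(x, e k)|^2],

      [\sum_(k >= n) lam k * a k <= (Bz, z) <= M |x - x_n|_+^2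
         <= K * omega (1 / lam n)^2 / lam n `^ (2 alpha - 1)].

    The series to be bounded is [\sum_k lam k `^ (2 alpha) * a k].  Cut it into
    the blocks [2^j <= lam k < 2^(j+1)].  On such a block the factor
    [lam k `^ (2 alpha - 1)] varies by at most [2 `^ (2 alpha - 1)], so the tail
    estimate at the first index of the block bounds the block by a constant
    times [omega (2^-j)^2] ([block_sum_le]).  By the Dini condition
    [\sum_j omega (2^-j)] converges ([dini_dyadic_sum]), and the squares
    are summable a fortiori.  The terms with [lam k < 1] are controlled by
    Bessel's inequality ([power_sum_bounded]).

    The comparison of the energy norms has two parts.  As [A] is positive
    definite, [0] is no eigenvalue; the spectrum of [A] consists of eigenvalues,
    so [0] is in the resolvent set and [A] has a bounded inverse.  The function
    [w |-> |B A^-1 w|] is then an everywhere finite, lower semicontinuous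
    seminorm on a complete space; such a seminorm is bounded
    ([lsc_seminorm_bounded]), that is, [|Bz| <= M |Az|]
    ([relatively_bounded]).  Secondly, [|Bz| <= M |Az|] implies
    [(Bz, z) <= M (Az, z)] ([form_domination]).  This is a case of Heinz's
    inequality, proved by a duality and an iteration.  By duality [G = A^-1 B]
    has norm at most [M]; it is symmetric for the form [(Au, v)], and iterating
    the Cauchy-Schwarz inequality of this form along the powers [G^(2^k)] turns
    the norm bound into the form bound. *)

(** * Lower semicontinuous seminorms on a complete space *)

Section RealNorm.
Context {R : realType} {H : completeNormedModType R[i]}.
Implicit Types (u v w : H) (a c : R).

(** The norm of [H] is a complex number with zero imaginary part; taking it in
    [R] makes its values totally ordered. *)
Definition rnorm u : R := complex.Re `|u|.

Lemma rnormE u : (rnorm u)%:C = `|u|.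
Proof. by rewrite /rnorm RRe_real// normr_real. Qed.

Lemma rnorm_ge0 u : 0 <= rnorm u.
Proof. by rewrite -ler0c rnormE. Qed.

Lemma rnorm_eq0 u : rnorm u = 0 -> u = 0.
Proof. by move=> u0; apply: normr0_eq0; rewrite -rnormE u0. Qed.

Lemma rnorm_gt0 u : u != 0 -> 0 < rnorm u.
Proof.
move=> u0; rewrite lt_neqAle rnorm_ge0 andbT eq_sym.
by apply: contra u0 => /eqP /rnorm_eq0 ->.
Qed.

Lemma rnormD u v : rnorm (u + v) <= rnorm u + rnorm v.
Proof. by rewrite -lecR rmorphD/= !rnormE ler_normD. Qed.

Lemma rnormZ a u : rnorm (a%:C *: u) = `|a| * rnorm u.
Proof.
apply: (@complexI R); rewrite rmorphM/= !rnormE normrZ; congr (_ * _).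
by rewrite normc_def/= expr0n addr0 sqrtr_sqr.
Qed.

Lemma rnormN u : rnorm (- u) = rnorm u.
Proof. by rewrite /rnorm normrN. Qed.

Lemma rnorm_distC u v : rnorm (u - v) = rnorm (v - u).
Proof. by rewrite -rnormN opprB. Qed.

Lemma rnorm_cauchy_cvg (x_ : nat -> H) (r_ : nat -> R) :
  (forall n k, rnorm (x_ (n + k)%N - x_ n) <= r_ n) ->
  (forall eps, 0 < eps -> exists n, r_ n < eps) ->
  exists l, forall eps, 0 < eps ->
    exists m, forall n, (m <= n)%N -> rnorm (l - x_ n) < eps.
Proof.
move=> xr r0.
have /cvg_ex[l xl] : cvg (x_ @ \oo).
  apply: cauchy_cvg; apply: cauchy_exP => eps eps0.
  have epsE : eps = (complex.Re eps)%:C by rewrite RRe_real// gtr0_real.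
  have [|n rn] := r0 (complex.Re eps); first by rewrite -ltcR -epsE.
  exists (x_ n); exists n => // m /= nm; rewrite -ball_normE /=.
  rewrite epsE -rnormE ltcR rnorm_distC -(subnKC nm).
  exact: le_lt_trans (xr _ _) rn.
exists l => eps eps0.
have /cvgrPdist_lt/(_ eps%:C) := xl.
rewrite ltcR => /(_ eps0)[m _ mP]; exists m => n mn.
by rewrite -ltcR rnormE; exact: mP.
Qed.

(** Otherwise [p] is unbounded on every ball.  By lower semicontinuity, each
    ball then contains a smaller one on which [p > n], for any given [n]; a
    point common to a nested sequence of such balls would have infinite
    seminorm. *)
Lemma lsc_seminorm_bounded (p : H -> R) :
  (forall u v, p (u + v) <= p u + p v) ->
  (forall a u, p (a%:C *: u) = `|a| * p u) ->
  (forall w c, c < p w ->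
    exists2 d, 0 < d & forall w', rnorm (w' - w) < d -> c < p w') ->
  exists M, forall u, p u <= M * rnorm u.
Proof.
move=> pD pZ plsc; apply: contrapT => /forallNP unb.
have {}unb M : exists u, M * rnorm u < p u.
  by have /existsNP[u /negP] := unb M; rewrite -ltNge => ?; exists u.
have step (q : nat * (H * R)) : exists s : H * R, 0 < q.2.2 ->
    [/\ 0 < s.2, s.2 <= q.2.2 / 4, rnorm (s.1 - q.2.1) <= q.2.2 / 4 &
        forall z, rnorm (z - s.1) < s.2 -> q.1%:R < p z].
  case: q => n [x r] /=.
  have [r0|] := ltP 0 r; last by exists (x, r); move=> ?.
  have [xi xiP] := unb (4 / r * n%:R).
  have xi0 : xi != 0.
    apply/eqP => xi0; have := pZ 0 0; rewrite scaler0 normr0 mul0r => p0.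
    by move: xiP; rewrite xi0 p0 /rnorm normr0/= mulr0 ltxx.
  have N0 := rnorm_gt0 xi0.
  pose t := r / 4 / rnorm xi; pose eta := t%:C *: xi.
  have t0 : 0 < t by rewrite !divr_gt0.
  have Neta : rnorm eta = r / 4.
    by rewrite rnormZ gtr0_norm// divfK// gt_eqF.
  have peta : n%:R < p eta.
    rewrite pZ gtr0_norm//.
    have -> : n%:R = t * (4 / r * n%:R * rnorm xi) :> R.
      by rewrite /t; field; rewrite !gt_eqF.
    by rewrite ltr_pM2l.
  (* The two points x + eta and x - eta differ by 2 eta, where p exceeds 2n, so
     p exceeds n at one of them. *)
  have [x' Nx' px'] : exists2 x', rnorm (x' - x) <= r / 4 & n%:R < p x'.
    have [pp|pp] := ltP n%:R (p (x + eta)).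
      by exists (x + eta) => //; rewrite addrC addKr Neta.
    have [pm|pm] := ltP n%:R (p (x - eta)).
      by exists (x - eta) => //; rewrite addrC addKr rnormN Neta.
    suff : 2 * p eta <= p (x + eta) + p (x - eta) by lra.
    have <- : p ((x + eta) + - (x - eta)) = 2 * p eta.
      have -> : x + eta + - (x - eta) = (2 : R)%:C *: eta.
        by rewrite opprB addrC addrA subrK rmorph_nat scaler_nat.
      by rewrite pZ ger0_norm.
    apply: le_trans (pD _ _) _; rewrite lerD2l.
    have := pZ (- 1) (x - eta).
    by rewrite rmorphN1 scaleN1r normrN1 mul1r => ->.
  have [d d0 dP] := plsc x' _ px'.
  exists (x', Num.min d (r / 4)) => _ /=; split => //.
  - by rewrite lt_min d0 divr_gt0.
  - by rewrite ge_min lexx orbT.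
  - by move=> z; rewrite lt_min => /andP[zd _]; exact: dP.
(* Shrinking the radius by 4 at each step keeps all later centres within half
   the current radius (x2 below), so the limit stays inside each open
   ball. *)
have {step}[f fP] := choice step.
pose s := fix s n := if n is m.+1 then f (m, s m) else (0 : H, 1 : R).
have s0 n : 0 < (s n).2.
  by elim: n => [|n IH] //=; have [] := fP (n, s n) IH.
have sP n := fP (n, s n) (s0 n).
have r4 n : (s n.+1).2 <= (s n).2 / 4 by have [] := sP n.
have x4 n : rnorm ((s n.+1).1 - (s n).1) <= (s n).2 / 4 by have [] := sP n.
have pP n z : rnorm (z - (s n.+1).1) < (s n.+1).2 -> n%:R < p z.
  by have [_ _ _] := sP n; exact.
have x2 n k : rnorm ((s (n + k)%N).1 - (s n).1) <= (s n).2 / 2.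
  elim: k n => [|k IH] n.
    by rewrite addn0 subrr /rnorm normr0 /= divr_ge0// ltW.
  rewrite -(subrKA (s n.+1).1); apply: le_trans (rnormD _ _) _.
  have := IH n.+1; rewrite addSnnS.
  have := r4 n; have := x4 n; have := s0 n; lra.
have rn n : (s n).2 * n.+1%:R <= 1.
  elim: n => [|n IH]; first by rewrite mulr1.
  rewrite -[n.+2%:R]natr1; have := r4 n; have := s0 n.+1.
  move: IH; have : 1 <= n.+1%:R :> R by rewrite ler1n.
  by move: (s n.+1).2 (s n).2 (n.+1%:R) => a b c; nra.
have [|eps eps0|l lP] := @rnorm_cauchy_cvg (fun n => (s n).1)
    (fun n => (s n).2 / 2).
- exact: x2.
- pose m := Num.bound eps^-1; exists m.
  have := archi_boundP (ltW (_ : 0 < eps^-1)); rewrite invr_gt0 => /(_ eps0).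
  rewrite -/m => me; have := rn m; have := s0 m; rewrite -natr1 => sm0 smm.
  suff : (s m).2 < eps by lra.
  rewrite -(@ltr_pM2r _ eps^-1) ?invr_gt0// divff ?gt_eqF//.
  have : (s m).2 * eps^-1 < (s m).2 * m%:R by rewrite ltr_pM2l.
  lra.
pose n := Num.bound `|p l|.
suff : n%:R < p l.
  apply/negP; rewrite -leNgt (le_trans (ler_norm _))// ltW//.
  by rewrite archi_boundP// normr_ge0.
apply: pP; have [|m mP] := lP ((s n.+1).2 / 4); first by rewrite divr_gt0.
rewrite -(subrKA (s (n.+1 + m)%N).1); apply: le_lt_trans (rnormD _ _) _.
have := mP (n.+1 + m)%N (leq_addl _ _); have := x2 n.+1 m; have := s0 n.+1.
lra.
Qed.

End RealNorm.

(** * The real inner product *)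

Section RealInnerProduct.
Context {R : realType} {H : completeNormedModType R[i]}.
Variable ip : {dot H for @Num.conj R[i]}.
Hypothesis ip_norm : is_inner_product_of_norm ip.
Implicit Types (u v w : H) (a : R) (A B : operator H).

(** All the estimates concern norms and quadratic forms, for which real scalars
    suffice. *)
Definition rip u v : R := complex.Re (ip u v).

Lemma ipC u v : ip u v = (ip v u)^*%C.
Proof. by rewrite (hermC ip) expr0 mul1r. Qed.

Lemma ripC u v : rip u v = rip v u.
Proof. by rewrite /rip ipC; case: (ip v u). Qed.

Lemma ripDl u v w : rip (u + v) w = rip u w + rip v w.
Proof. by rewrite /rip linearDl raddfD. Qed.

Lemma ripZl a u v : rip (a%:C *: u) v = a * rip u v.
Proof. by rewrite /rip linearZl_LR /=; case: (ip u v) => x y /=; ring. Qed.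

Lemma ripDr u v w : rip w (u + v) = rip w u + rip w v.
Proof. by rewrite !(ripC w) ripDl. Qed.

Lemma ripZr a u v : rip u (a%:C *: v) = a * rip u v.
Proof. by rewrite !(ripC u) ripZl. Qed.

Lemma ripNl u v : rip (- u) v = - rip u v.
Proof. by rewrite /rip linearNl raddfN. Qed.

Lemma ripBl u v w : rip (u - v) w = rip u w - rip v w.
Proof. by rewrite ripDl ripNl. Qed.

Lemma rip_rnorm u : rip u u = rnorm u ^+ 2.
Proof. by rewrite /rip -ip_norm -rnormE -rmorphXn. Qed.

End RealInnerProduct.

(** * Two inequalities for real numbers *)

Lemma discriminant_le0 {R : realFieldType} (a b c : R) :
  0 <= c -> (forall t, 0 <= a + 2 * t * b + t ^+ 2 * c) -> b ^+ 2 <= a * c.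
Proof.
move=> c0 q; have [c1|c1] := eqVneq c 0.
  suff -> : b = 0 by rewrite c1 expr0n mulr0.
  apply/eqP/negPn/negP => b0; have := q (- (a + 1) / (2 * b)).
  rewrite c1 mulr0 addr0.
  have -> : a + 2 * (- (a + 1) / (2 * b)) * b = -1 by field.
  by rewrite lerNr oppr0 ler10.
have cp : 0 < c by rewrite lt_neqAle eq_sym c1.
have := q (- b / c).
have -> : a + 2 * (- b / c) * b + (- b / c) ^+ 2 * c = (a * c - b ^+ 2) / c.
  by field.
by rewrite pmulr_lge0 ?invr_gt0// subr_ge0.
Qed.

(** If [s 0 = 1 + d] with [d > 0], repeated squaring already forces linear
    growth: [s k >= 1 + (k + 1) d]. *)
Lemma squaring_bounded_le1 {R : realType} (s : nat -> R) (C : R) :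
  (forall k, s k ^+ 2 <= s k.+1) -> (forall k, s k <= C) -> s 0%N <= 1.
Proof.
move=> s2 sC; rewrite leNgt; apply/negP => s1.
pose d := s 0%N - 1.
have d0 : 0 < d by rewrite subr_gt0.
have sd k : 1 + k.+1%:R * d <= s k.
  elim: k => [|k IH]; first by rewrite mul1r /d; lra.
  apply: le_trans (s2 k).
  have : (1 + k.+1%:R * d) ^+ 2 <= s k ^+ 2.
    by rewrite ler_pXn2r// nnegrE ?(le_trans _ IH)// addr_ge0// mulr_ge0// ltW.
  apply: le_trans; rewrite -(natr1 k.+1).
  have : 1 <= k.+1%:R :> R by rewrite ler1n.
  by move: (k.+1%:R) => n n1; nra.
have := archi_boundP (normr_ge0 (C / d)); set m := Num.bound _ => Cm.
have := sd m; have := sC m; have := ler_norm (C / d).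
have -> : C = C / d * d by rewrite divfK// gt_eqF.
rewrite mulfK ?gt_eqF// -natr1.
move: (C / d) (`|C / d|) (m%:R) Cm (s m) => x y z xy w xy' *.
have : x * d < z * d by rewrite ltr_pM2r//; lra.
by nra.
Qed.

(** * Symmetric operators and their quadratic forms *)

Section SymmetricOperators.
Context {R : realType} {H : completeNormedModType R[i]}.
Variable ip : {dot H for @Num.conj R[i]}.
Hypothesis ip_norm : is_inner_product_of_norm ip.
Implicit Types (u v w : H) (a : R) (A B : operator H).
Local Notation rip := (rip ip).

Definition symmetric_operator A : Prop := linear_operator A /\
  forall u v, dom A u -> dom A v -> ip (A u) v = ip u (A v).

Lemma self_adjoint_symmetric A : self_adjoint ip A -> symmetric_operator A.
Proof.
move=> [lA _ AP]; split=> // u v Du Dv.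
by have [/(_ (conj Dv erefl))/(_ _ Du)] := AP v (A v).
Qed.

Lemma positive_definite_rip A : positive_definite ip A ->
  exists2 gamma, 0 < gamma &
    forall u, dom A u -> gamma * rnorm u ^+ 2 <= rip (A u) u.
Proof.
case=> g g0 gP; exists g => // u /gP.
by rewrite -rnormE lecE -rmorphXn -rmorphM => /andP[].
Qed.

Section OneOperator.
Variable A : operator H.
Hypothesis A_sym : symmetric_operator A.

Lemma dom0 : dom A 0. Proof. by have [[]] := A_sym. Qed.

Lemma domZD (c : R[i]) u v : dom A u -> dom A v -> dom A (c *: u + v).
Proof. by have [[_ + _ _]] := A_sym; exact. Qed.

Lemma operatorZD (c : R[i]) u v : dom A u -> dom A v ->
  A (c *: u + v) = c *: A u + A v.
Proof. by have [[_ _ + _]] := A_sym; exact. Qed.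

Lemma domD u v : dom A u -> dom A v -> dom A (u + v).
Proof. by move=> Du Dv; rewrite -[u]scale1r; exact: domZD. Qed.

Lemma operatorD u v : dom A u -> dom A v -> A (u + v) = A u + A v.
Proof.
by move=> Du Dv; have := operatorZD 1 Du Dv; rewrite !scale1r.
Qed.

Lemma operator0 : A 0 = 0.
Proof.
by have /eqP := operatorD dom0 dom0; rewrite addr0 -subr_eq subrr => /eqP.
Qed.

Lemma domZ (c : R[i]) u : dom A u -> dom A (c *: u).
Proof. by move=> Du; rewrite -[_ *: _]addr0; exact: domZD dom0. Qed.

Lemma operatorZ (c : R[i]) u : dom A u -> A (c *: u) = c *: A u.
Proof.
by move=> Du; have := operatorZD c Du dom0; rewrite operator0 !addr0.
Qed.

Lemma domB u v : dom A u -> dom A v -> dom A (u - v).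
Proof. by move=> Du Dv; rewrite -scaleN1r addrC; exact: domZD. Qed.

Lemma operatorB u v : dom A u -> dom A v -> A (u - v) = A u - A v.
Proof.
by move=> Du Dv; rewrite -scaleN1r addrC operatorZD// scaleN1r addrC.
Qed.

Lemma operator_sum (I : Type) (r : seq I) (c : I -> R[i]) (f : I -> H) :
  (forall i, dom A (f i)) ->
  dom A (\sum_(i <- r) c i *: f i) /\
  A (\sum_(i <- r) c i *: f i) = \sum_(i <- r) c i *: A (f i).
Proof.
move=> fD; elim: r => [|i r [IHD IH]].
  by rewrite !big_nil operator0; split => //; exact: dom0.
by rewrite !big_cons operatorZD// IH; split => //; exact: domZD.
Qed.

Lemma rip_symmetric u v : dom A u -> dom A v -> rip (A u) v = rip u (A v).
Proof.
by move=> Du Dv; have [_ AS] := A_sym; rewrite /rip AS.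
Qed.

Hypothesis A_pos : forall u, dom A u -> 0 <= rip (A u) u.

Lemma form_cauchy_schwarz u v : dom A u -> dom A v ->
  rip (A u) v ^+ 2 <= rip (A u) u * rip (A v) v.
Proof.
move=> Du Dv; apply: discriminant_le0; first exact: A_pos.
move=> t; have Dtv : dom A (t%:C *: v) by exact: domZ.
have := A_pos (domD Du Dtv).
rewrite operatorD// operatorZ// !(ripDl, ripDr, ripZl, ripZr).
rewrite (rip_symmetric Dv Du) (ripC _ v) => /le_trans; apply.
by rewrite le_eqVlt; apply/orP; left; apply/eqP; ring.
Qed.

End OneOperator.

(** With the identity as an operator, the Cauchy-Schwarz and Bessel inequalities
    of the inner product are instances of inequalities for forms. *)
Definition identity : operator H := Operator setT id.

Lemma identity_symmetric : symmetric_operator identity.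
Proof. by []. Qed.

Lemma rip_cauchy_schwarz u v : `|rip u v| <= rnorm u * rnorm v.
Proof.
have pos w : dom identity w -> 0 <= rip (identity w) w.
  by move=> _; rewrite rip_rnorm// sqr_ge0.
have := form_cauchy_schwarz identity_symmetric pos (I : dom identity u)
  (I : dom identity v).
rewrite !rip_rnorm// -exprMn -[leLHS]real_normK ?num_real// ler_pXn2r//.
by rewrite nnegrE mulr_ge0// rnorm_ge0.
Qed.

Lemma rip_le_rnorm u v : rip u v <= rnorm u * rnorm v.
Proof. exact: le_trans (ler_norm _) (rip_cauchy_schwarz _ _). Qed.

End SymmetricOperators.
(** * Comparison of the energy forms of two operators with the same domain *)

Section RelativeBound.
Context {R : realType} {H : completeNormedModType R[i]}.
Variable ip : {dot H for @Num.conj R[i]}.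
Hypothesis ip_norm : is_inner_product_of_norm ip.
Implicit Types (u v w : H).
Local Notation rip := (rip ip).

Lemma dense_rnorm (D : set H) w (eps : R) : dense D -> 0 < eps ->
  exists2 v, D v & rnorm (v - w) < eps.
Proof.
move=> dD eps0; have eps0' : 0 < eps%:C by rewrite ltcR.
have [||v [/interior_subset]] := dD (interior (ball w eps%:C)).
- by exists w; exact: nbhsx_ballx.
- exact: open_interior.
rewrite -ball_normE /= => wv Dv; exists v => //.
by rewrite rnorm_distC -ltcR rnormE.
Qed.

Variables A B : operator H.
Hypotheses (A_sym : symmetric_operator ip A) (B_sym : symmetric_operator ip B).
Hypothesis domAB : dom A = dom B.
Hypothesis A_surj : forall w, exists u, dom A u /\ A u = w.
Hypothesis A_below :
  exists C : R, forall u, dom A u -> rnorm u <= C * rnorm (A u).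

(** The seminorm [w |-> |B A^-1 w|] is lower semicontinuous: it is the supremum
    of [(B A^-1 w, v) / |v|] over [v] in the dense domain of [B], and each
    [w |-> (B A^-1 w, v) = (A^-1 w, B v)] is continuous because [A^-1] is
    bounded. *)
Lemma relatively_bounded : dense (dom B) ->
  exists2 M, 0 < M & forall u, dom A u -> rnorm (B u) <= M * rnorm (A u).
Proof.
move=> B_dense; have [C CP] := A_below.
have A_inj u v : dom A u -> dom A v -> A u = A v -> u = v.
  move=> Du Dv Auv; have := CP _ (domB A_sym Du Dv).
  rewrite (operatorB A_sym)// Auv subrr /rnorm normr0 mulr0 => le0.
  apply/eqP; rewrite -subr_eq0; apply/eqP; apply: rnorm_eq0; apply/eqP.
  by rewrite eq_le le0 rnorm_ge0.
have [Ainv AinvP] := choice A_surj.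
have DAinv w : dom A (Ainv w) by have [] := AinvP w.
have DBinv w : dom B (Ainv w) by rewrite -domAB.
have AAinv w : A (Ainv w) = w by have [] := AinvP w.
have AinvD u v : Ainv (u + v) = Ainv u + Ainv v.
  apply: A_inj => //; first exact: (domD A_sym).
  by rewrite (operatorD A_sym)// !AAinv.
have AinvZ (c : R[i]) u : Ainv (c *: u) = c *: Ainv u.
  apply: A_inj => //; first exact: (domZ A_sym).
  by rewrite (operatorZ A_sym)// !AAinv.
have [|||M MP] := @lsc_seminorm_bounded _ _ (fun w => rnorm (B (Ainv w))).
- by move=> u v; rewrite AinvD (operatorD B_sym)// rnormD.
- by move=> a u; rewrite AinvZ (operatorZ B_sym)// rnormZ.
- move=> w c; have [c0 _|c0 cw] := ltP c 0.
    by exists 1 => // w' _; exact: lt_le_trans c0 (rnorm_ge0 _).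
  set z := B (Ainv w) in cw *.
  have z0 : 0 < rnorm z := le_lt_trans c0 cw.
  (* The inequality holds strictly for v = z, hence for v near z: it survives a
     perturbation of size d as soon as d (|z| + c) < |z| (|z| - c), and eps is
     half the threshold for d. *)
  have [v Dv vz] : exists2 v, dom B v & c * rnorm v < rip z v.
    pose eps := rnorm z * (rnorm z - c) / (2 * (rnorm z + c)).
    have eps0 : 0 < eps.
      by rewrite divr_gt0// ?mulr_gt0// ?subr_gt0// ltr_wpDr.
    have [v Dv vz] := dense_rnorm z B_dense eps0.
    exists v => //.
    have -> : v = z + (v - z) by rewrite addrC subrK.
    have := rnormD z (v - z); rewrite ripDr rip_rnorm//.
    have := rip_le_rnorm ip_norm (- z) (v - z); rewrite ripNl rnormN.
    have : 2 * eps * (rnorm z + c) = rnorm z * (rnorm z - c).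
      by rewrite /eps; field; rewrite gt_eqF// ltr_wpDr.
    have := rnorm_ge0 (v - z).
    move: (rnorm (v - z)) (rip z _) (rnorm (z + _)) vz z0 c0 cw eps0.
    move: (rnorm z) => Z d s n *; nra.
  pose K := C * rnorm (B v).
  pose g := rip z v - c * rnorm v.
  have g0 : 0 < g by rewrite subr_gt0.
  exists (g / (`|K| + 1)); first by rewrite divr_gt0// ltr_wpDl.
  move=> w' w'w.
  have K0 : 0 < `|K| + 1 by rewrite ltr_wpDl.
  rewrite ltr_pdivlMr// in w'w.
  have Bpair t : rip (B (Ainv t)) v = rip (Ainv t) (B v).
    exact: (rip_symmetric B_sym).
  have diff : rip z v - rip (B (Ainv w')) v <= K * rnorm (w' - w).
    rewrite !Bpair -ripBl.
    have -> : Ainv w - Ainv w' = Ainv (w - w').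
      by rewrite -!(scaleN1r w') AinvD AinvZ scaleN1r.
    apply: le_trans (rip_le_rnorm ip_norm _ _) _.
    rewrite /K mulrAC ler_wpM2r ?rnorm_ge0// rnorm_distC.
    by have := CP _ (DAinv (w - w')); rewrite AAinv.
  have KK : K * rnorm (w' - w) <= rnorm (w' - w) * (`|K| + 1).
    rewrite mulrC ler_wpM2l ?rnorm_ge0//.
    by rewrite (le_trans (ler_norm _))// lerDl.
  have v0 : 0 <= rnorm v := rnorm_ge0 v.
  have : c * rnorm v < rnorm (B (Ainv w')) * rnorm v.
    have := rip_le_rnorm ip_norm (B (Ainv w')) v; rewrite /g in w'w; lra.
  have [->|vn0] := eqVneq v 0; first by rewrite /rnorm normr0 !mulr0 ltxx.
  by rewrite ltr_pM2r// rnorm_gt0.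
exists (`|M| + 1); first by rewrite ltr_wpDl.
move=> u Du; have := MP (A u).
rewrite (A_inj (Ainv (A u)) u)// => /le_trans; apply.
by rewrite ler_wpM2r ?rnorm_ge0// (le_trans (ler_norm _))// lerDl.
Qed.

Hypothesis A_pos : forall u, dom A u -> 0 <= rip (A u) u.

(** With [G = A^-1 B], [|(u, Gv)| = |(B A^-1 u, v)|] shows [|Gu| <= M |u|].
    Put [q n = (A G^n u, u)].  As [G] is symmetric for the form of [A], the
    Cauchy-Schwarz inequality gives [q n ^ 2 <= q (2n) * q 0], while
    [q n <= M^n |u| |Au|].  Hence the numbers
    [s k = q (2^k) / (q 0 * M^(2^k))] are bounded and satisfy
    [s k ^ 2 <= s (k + 1)], which forces [s 0 <= 1] when
    [q 0 > 0]; when [q 0 = 0], the bound [q 1 ^ 2 <= q 2 * q 0] gives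
    [q 1 = 0]. *)
Lemma form_domination (M : R) : 0 < M ->
  (forall u, dom A u -> rnorm (B u) <= M * rnorm (A u)) ->
  forall u, dom A u -> rip (B u) u <= M * rip (A u) u.
Proof.
move=> M0 BA u Du; have [Ainv AinvP] := choice A_surj.
have DAinv w : dom A (Ainv w) by have [] := AinvP w.
have AAinv w : A (Ainv w) = w by have [] := AinvP w.
pose G w := Ainv (B w).
have DG w : dom A (G w) by exact: DAinv.
have AG w : A (G w) = B w by exact: AAinv.
have DB w : dom A w -> dom B w by rewrite domAB.
have NG w : dom A w -> rnorm (G w) <= M * rnorm w.
  move=> Dw; have [->|Gw0] := eqVneq (G w) 0.
    by rewrite {1}/rnorm normr0 mulr_ge0 ?rnorm_ge0// ltW.
  rewrite -(ler_pM2r (rnorm_gt0 Gw0)) -expr2 -(rip_rnorm ip_norm).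
  rewrite -{2}(AAinv (G w)) -(rip_symmetric A_sym)// AG.
  rewrite (rip_symmetric B_sym (DB _ Dw) (DB _ (DAinv _))).
  apply: le_trans (rip_le_rnorm ip_norm _ _) _.
  rewrite [leRHS]mulrAC [leRHS]mulrC ler_wpM2l ?rnorm_ge0// mulrC.
  by have := BA _ (DAinv (G w)); rewrite AAinv mulrC.
have Diter n w : dom A w -> dom A (iter n G w).
  by case: n => [|n] Dw; [exact: Dw|exact: DG].
have Niter n : rnorm (iter n G u) <= M ^+ n * rnorm u.
  elim: n => [|n IH] /=; first by rewrite mul1r.
  apply: le_trans (NG _ (Diter _ _ Du)) _.
  by rewrite exprS -mulrA ler_wpM2l// ltW.
have Gsym v w : dom A v -> dom A w -> rip (A (G v)) w = rip (A v) (G w).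
  move=> Dv Dw; rewrite AG (rip_symmetric B_sym (DB _ Dv) (DB _ Dw)) -AG.
  by rewrite (rip_symmetric A_sym).
have Gnsym n v : dom A v -> rip (A v) (iter n G u) = rip (A (iter n G v)) u.
  elim: n v => [|n IH] v Dv //=.
  by rewrite -(Gsym _ _ Dv (Diter n u Du)) (IH _ (DG v)) -iterSr.
pose b := rip (A u) u.
pose q n := rip (A (iter n G u)) u.
have q2 n : q n ^+ 2 <= q (n + n)%N * b.
  apply: le_trans (form_cauchy_schwarz A_sym A_pos (Diter n u Du) Du) _.
  by rewrite (Gnsym _ _ (Diter n u Du)) -iterD.
have q1E : q 1%N = rip (B u) u by rewrite /q /= AG.
rewrite -q1E -/b.
have [b0|b0] := eqVneq b 0.
  have := q2 1%N; rewrite b0 !mulr0.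
  rewrite -[q 1%N ^+ 2]real_normK ?num_real// exprn_even_le0//=.
  by rewrite normr_eq0 => /eqP ->.
have bp : 0 < b by rewrite lt_neqAle eq_sym b0 A_pos.
rewrite mulrC -ler_pdivrMl//.
pose s k := q (2 ^ k)%N / (b * M ^+ (2 ^ k)).
have := @squaring_bounded_le1 _ s (rnorm u * rnorm (A u) / b).
have -> : s 0%N = q 1%N / (b * M) by rewrite /s expn0 expr1.
rewrite ler_pdivrMr ?mulr_gt0// mul1r => s1.
rewrite ler_pdivrMl//; apply: s1 => k.
  rewrite /s expnS mul2n -addnn exprD expr_div_n.
  rewrite ler_pdivrMr ?exprn_gt0 ?mulr_gt0 ?exprn_gt0//.
  apply: le_trans (q2 _) _.
  rewrite le_eqVlt; apply/orP; left; apply/eqP; field.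
  by rewrite b0 ?expf_neq0 ?gt_eqF.
rewrite /s invfM mulrA mulrAC ler_wpM2r ?invr_ge0 ?(ltW bp)//.
rewrite ler_pdivrMr ?exprn_gt0// /q.
rewrite (rip_symmetric A_sym (Diter _ u Du) Du).
apply: le_trans (rip_le_rnorm ip_norm _ _) _.
rewrite [leRHS]mulrAC ler_wpM2r ?rnorm_ge0// [leRHS]mulrC.
exact: Niter.
Qed.

End RelativeBound.

(** * Forms in an orthonormal system of eigenvectors *)

Section DiagonalForm.
Context {R : realType} {H : completeNormedModType R[i]}.
Variable ip : {dot H for @Num.conj R[i]}.

(** Split [z = p + r], with [p] the orthogonal projection of [z] on the first
    [n] eigenvectors.  The remainder [r] is orthogonal to [S p], so the form of
    [S] at [z] is the sum of its values at [p] and [r]; the first is the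
    left-hand side and the second is nonnegative. *)
Lemma diagonal_form_le (S : operator H) (mu : nat -> R) (e : nat -> H) :
  symmetric_operator ip S ->
  (forall u, dom S u -> 0 <= rip ip (S u) u) ->
  (forall j k, ip (e j) (e k) = (j == k)%:R) ->
  (forall k, dom S (e k) /\ S (e k) = (mu k)%:C *: e k) ->
  forall z n, dom S z ->
    \sum_(k < n) mu k * (complex.Re `|ip z (e k)|) ^+ 2 <= rip ip (S z) z.
Proof.
move=> S_sym S_pos e_orth eS z n Dz.
pose p := \sum_(k < n) ip z (e k) *: e k.
have [Dp Sp] := @operator_sum _ _ _ _ S_sym _ (index_enum 'I_n)
  (fun k : 'I_n => ip z (e k)) (fun k : 'I_n => e k) (fun k => (eS k).1).
rewrite -/p in Dp Sp.
pose r := z - p; have Dr : dom S r by exact: (domB S_sym).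
have zE : z = p + r by rewrite addrC subrK.
have r_orth (k : 'I_n) : ip r (e k) = 0.
  rewrite linearBl /p linear_sumlz (bigD1 k)//= big1; last first.
    move=> j jk; rewrite linearZl_LR /= e_orth.
    by rewrite (negbTE (jk : val j != val k)) mulr0.
  by rewrite linearZl_LR /= e_orth eqxx mulr1 addr0 subrr.
have Spw w : rip ip (S p) w =
    \sum_(k < n) mu k * complex.Re (ip z (e k) * ip (e k) w).
  rewrite /rip Sp linear_sumlz raddf_sum; apply: eq_bigr => k _.
  rewrite (eS k).2 !linearZl_LR /= mulrCA.
  by case: (ip z (e k) * ip (e k) w) => x y /=; ring.
have Spr : rip ip (S p) r = 0.
  rewrite Spw big1// => k _.
  by rewrite (ipC ip (e k)) r_orth conjc0 mulr0 /= mulr0.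
have -> : \sum_(k < n) mu k * complex.Re `|ip z (e k)| ^+ 2 = rip ip (S p) z.
  rewrite Spw; apply: eq_bigr => k _; congr (_ * _).
  rewrite (ipC ip (e k)); case: (ip z (e k)) => x y.
  rewrite normc_def /= sqr_sqrtr ?addr_ge0 ?sqr_ge0//; ring.
rewrite {2}zE (operatorD S_sym Dp Dr) ripDl lerDl.
rewrite {1}zE ripDr (rip_symmetric S_sym Dr Dp) (ripC _ r) Spr add0r.
exact: S_pos.
Qed.

End DiagonalForm.

(** * The Dini condition on dyadic points *)

Section Dini.
Context {R : realType}.
Variable omega : R -> R.
Hypothesis omega_cont : {within `[0, +oo[, continuous omega}.
Hypothesis omega_nondecr : {in `[0, +oo[ &, {homo omega : s t / s <= t}}.
Hypothesis omega0 : omega 0 = 0.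

Lemma modulus_ge0 t : 0 <= t -> 0 <= omega t.
Proof. by move=> t0; rewrite -omega0 omega_nondecr// in_itv/= ?lexx ?andbT. Qed.

Lemma modulus_le s t : 0 <= s -> s <= t -> omega s <= omega t.
Proof.
move=> s0 st; apply: omega_nondecr => //; rewrite in_itv/= andbT//.
exact: le_trans st.
Qed.

Local Notation mu := (@lebesgue_measure R).
Local Notation f := (fun t : R => (omega t / t)%:E).

Lemma measurable_modulus_div :
  measurable_fun (`]0, 1]%classic : set R) (EFin \o (fun t => omega t / t)).
Proof.
apply/measurable_EFinP; apply: measurable_funM.
  have sub : `]0, 1]%classic `<=` (`[0, +oo[%classic : set R).
    by move=> t /=; rewrite !in_itv/= andbT => /andP[/ltW].
  apply: measurable_funS sub _ => //.
  exact: subspace_continuous_measurable_fun.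
have sub : `]0, 1]%classic `<=` (`]0, +oo[%classic : set R).
  by move=> t /=; rewrite !in_itv/= andbT => /andP[].
apply: measurable_funS sub _ => //.
apply: open_continuous_measurable_fun; first exact: interval_open.
move=> t; rewrite inE/= in_itv/= andbT => t0; apply: inv_continuous.
by rewrite gt_eqF.
Qed.

Lemma modulus_div_ge0 t : `]0%R, 1%R]%classic t -> (0 <= f t)%E.
Proof.
rewrite /= in_itv/= => /andP[/ltW t0 _].
by rewrite lee_fin divr_ge0// modulus_ge0.
Qed.

(** On [(2^-(n+1), 2^-n]], of length [2^-(n+1)], the integrand is at least
    [omega (2^-(n+1)) / 2^-n]. *)
Lemma dyadic_sum_le_integral n :
  (\sum_(j < n) (omega (2 ^- j.+1) / 2)%:E <=
   \int[mu]_(t in `](2 ^- n)%R, 1%R]) f t)%E.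
Proof.
have p0 k : 0 < 2 ^- k :> R by rewrite invr_gt0 exprn_gt0.
have p1 k : 2 ^- k <= 1 :> R.
  by rewrite invf_le1 ?exprn_gt0// exprn_ege1// ler1n.
elim: n => [|n IH].
  rewrite big_ord0; apply: integral_ge0 => t; rewrite expr0 invr1 /= in_itv/=.
  by case: ltP => //= t1; rewrite leNgt t1.
have half : 2 ^- n = 2 * 2 ^- n.+1 :> R.
  by rewrite exprS invfM mulrA divff// mul1r.
have split_itv : `](2 ^- n.+1)%R, 1%R]%classic =
    `](2 ^- n.+1)%R, (2 ^- n)%R] `|` `](2 ^- n)%R, 1%R] :> set R.
  rewrite -itv_bndbnd_setU// bnd_simp; last exact: p1.
  by have := p0 n.+1; have := half; lra.
have sub k : `](2 ^- k)%R, 1%R] `<=` (`]0, 1]%classic : set R).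
  move=> t /=; rewrite !in_itv/= => /andP[ta ->].
  by rewrite (lt_trans (p0 k) ta).
rewrite split_itv ge0_integral_setU//; first last.
- apply/disj_setPS => t [] /=; rewrite !in_itv/=.
  by move=> /andP[_ a] /andP[b _]; move: (le_lt_trans a b); rewrite ltxx.
- move=> t; rewrite -split_itv => /sub; exact: modulus_div_ge0.
- rewrite -split_itv.
  by apply: (measurable_funS _ (@sub _) measurable_modulus_div).
rewrite big_ord_recr/= addeC leeD//.
set c := omega (2 ^- n.+1) * 2 ^+ n.
have -> : (omega (2 ^- n.+1) / 2)%:E =
    (\int[mu]_(t in `](2 ^- n.+1)%R, (2 ^- n)%R]) cst c%:E t)%E.
  rewrite integral_cst//= lebesgue_measure_itv/= lte_fin.
  rewrite half ltr_pMl// ltr1n -EFinB -EFinM; congr EFin.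
  by rewrite /c exprS; field; rewrite expf_neq0.
have sub2 :
    `](2 ^- n.+1)%R, (2 ^- n)%R] `<=` (`](2 ^- n.+1), 1]%classic : set R).
  by rewrite split_itv; left.
apply: ge0_le_integral => //.
- by move=> t _; rewrite lee_fin mulr_ge0 ?exprn_ge0// modulus_ge0// ltW.
- have sub3 := subset_trans sub2 (@sub _).
  by apply: (measurable_funS _ sub3 measurable_modulus_div).
- move=> t /=; rewrite in_itv/= => /andP[ta tb]; rewrite lee_fin.
  have t0 : 0 < t := lt_trans (p0 _) ta.
  apply: ler_pM.
  + by rewrite modulus_ge0// ltW.
  + by rewrite exprn_ge0.
  + by rewrite modulus_le// ltW.
  + by rewrite -[leLHS]invrK lef_pV2 ?posrE ?invr_gt0 ?exprn_gt0.
Qed.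

Lemma dini_dyadic_sum :
  (\int[mu]_(t in `]0%R, 1%R]) f t < +oo)%E ->
  exists C, forall n, \sum_(j < n) omega (2 ^- j) <= C.
Proof.
move=> dini; set I := (\int[mu]_(t in _) _)%E in dini.
have I0 : (0 <= I)%E by apply: integral_ge0 => t; exact: modulus_div_ge0.
have Ifin : I \is a fin_num by rewrite ge0_fin_numE.
exists (omega 1 + 2 * fine I) => -[|n].
  by rewrite big_ord0 addr_ge0 ?mulr_ge0 ?fine_ge0// modulus_ge0.
rewrite big_ord_recl expr0 invr1 lerD2l.
have : (\sum_(j < n) (omega (2 ^- j.+1) / 2)%:E <= I)%E.
  apply: le_trans (dyadic_sum_le_integral n) _.
  apply: ge0_subset_integral => //.
  - exact: measurable_modulus_div.
  - exact: modulus_div_ge0.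
  - move=> t /=; rewrite !in_itv/= => /andP[ta ->]; rewrite andbT.
    by apply: lt_trans ta; rewrite invr_gt0 exprn_gt0.
rewrite sumEFin -(fineK Ifin) lee_fin -mulr_suml ler_pdivrMr// mulrC.
exact.
Qed.

End Dini.

(** * Summation over dyadic blocks *)

Section DyadicBlocks.
Context {R : realType}.
Variables (lam a : nat -> R) (omega : R -> R) (beta K : R).
Hypothesis lam_gt0 : forall k, 0 < lam k.
Hypothesis lam_nondecr : {homo lam : k l / (k <= l)%N >-> k <= l}.
Hypothesis a_ge0 : forall k, 0 <= a k.
Hypothesis omega_ge0 : forall t, 0 <= t -> 0 <= omega t.
Hypothesis omega_le : forall s t, 0 <= s -> s <= t -> omega s <= omega t.
Hypotheses (beta_ge0 : 0 <= beta) (K_ge0 : 0 <= K).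
Hypothesis tail_le : forall n N, (0 < n)%N ->
  \sum_(n <= k < N) lam k * a k <= K * (omega (lam n)^-1 ^+ 2 / lam n `^ beta).

Definition in_block j k := (2 ^+ j <= lam k) && (lam k < 2 ^+ j.+1).

Lemma in_block_ex k J : 1 <= lam k -> lam k < 2 ^+ J ->
  exists j : 'I_J, in_block j k.
Proof.
move=> l1; elim: J => [|J IH] lJ; first by move: lJ; rewrite expr0 ltNge l1.
have [/IH [j jP]|lJ'] := ltP (lam k) (2 ^+ J).
  by exists (widen_ord (leqnSn J) j).
by exists ord_max; rewrite /in_block lJ' lJ.
Qed.

Lemma powR1D l : 0 < l -> l `^ (1 + beta) = l `^ beta * l.
Proof.
by move=> l0; rewrite powRD ?(gt_eqF l0) ?implybT// powRr1 ?(ltW l0)// mulrC.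
Qed.

(** With [n] the first positive index such that [lam n >= 2^j], the block is
    part of the tail from [n] on.  There [lam k `^ beta] is at most
    [(2^(j+1)) `^ beta], and the factors [(2^j / lam n) `^ beta <= 1] and
    [omega (1 / lam n) <= omega (2^-j)] absorb the dependence on [n]. *)
Lemma block_sum_le j N :
  \sum_(1 <= k < N | in_block j k) lam k `^ (1 + beta) * a k <=
  2 `^ beta * K * omega (2 ^- j) ^+ 2.
Proof.
have p0 i : 0 < 2 ^+ i :> R by rewrite exprn_gt0.
have [ex|none] := pselect (exists k, (0 < k)%N && (2 ^+ j <= lam k));
  last first.
  rewrite big_nat_cond big1 => [|k /andP[/andP[k1 _] /andP[kj _]]].
    by rewrite mulr_ge0 ?sqr_ge0// mulr_ge0 ?powR_ge0.
  by case: none; exists k; rewrite k1.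
have [n /andP[n0 nj] nmin] := ex_minnP ex.
apply: (@le_trans _ _ (\sum_(n <= k < N) (2 ^+ j.+1) `^ beta * (lam k * a k))).
  have [nN|Nn] := leqP n N; last first.
    rewrite [leRHS]big_geq ?(ltnW Nn)// big_nat_cond big1// => k.
    move=> /andP[/andP[k1 kN] /andP[kj _]].
    have := nmin k; rewrite k1 kj => /(_ isT).
    by rewrite leqNgt (ltn_trans kN Nn).
  rewrite (@big_cat_nat _ _ _ n)//= [X in X + _]big_nat_cond big1 ?add0r.
    rewrite big_mkcond /= ler_sum// => k _.
    case: ifPn => [/andP[_ kj]|_]; last first.
      by rewrite !mulr_ge0 ?powR_ge0// ltW.
    rewrite powR1D// -mulrA ler_wpM2r ?mulr_ge0 ?(ltW (lam_gt0 _))//.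
    by rewrite ge0_ler_powR ?nnegrE ?(ltW kj) ?(ltW (p0 _)) ?(ltW (lam_gt0 _)).
  move=> k /andP[/andP[k1 kn] /andP[kj _]].
  have := nmin k; rewrite k1 kj => /(_ isT).
  by rewrite leqNgt kn.
rewrite -mulr_sumr.
apply: (@le_trans _ _ ((2 ^+ j.+1) `^ beta *
   (K * (omega (lam n)^-1 ^+ 2 / lam n `^ beta)))).
  by rewrite ler_wpM2l ?powR_ge0// tail_le.
rewrite exprS powRM// ?(ltW (p0 _))//.
have -> : 2 `^ beta * (2 ^+ j) `^ beta *
    (K * (omega (lam n)^-1 ^+ 2 / lam n `^ beta)) =
  2 `^ beta * K * ((2 ^+ j) `^ beta / lam n `^ beta * omega (lam n)^-1 ^+ 2).
  by ring.
rewrite ler_wpM2l ?mulr_ge0 ?powR_ge0// -[leRHS]mul1r.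
have l0 := ltW (lam_gt0 n); have li0 : 0 <= (lam n)^-1 by rewrite invr_ge0.
apply: ler_pM.
- by rewrite divr_ge0 ?powR_ge0.
- exact: sqr_ge0.
- rewrite ler_pdivrMr ?powR_gt0// mul1r ge0_ler_powR ?nnegrE//.
- have oj : 0 <= omega (2 ^- j) by rewrite omega_ge0// invr_ge0 ltW.
  rewrite ler_pXn2r ?nnegrE ?omega_ge0// omega_le//.
  by rewrite lef_pV2 ?posrE.
Qed.

(** The constant [S] accounts for the terms with [lam k < 1], the other summand
    for the dyadic blocks, through
    [omega (2^-j) ^ 2 <= omega 1 * omega (2^-j)]. *)
Lemma power_sum_bounded (S C : R) :
  (forall N, \sum_(1 <= k < N) a k <= S) ->
  (forall J, \sum_(j < J) omega (2 ^- j) <= C) ->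
  forall N, \sum_(1 <= k < N) lam k `^ (1 + beta) * a k <=
    S + 2 `^ beta * K * (omega 1 * C).
Proof.
move=> aS omegaC N.
pose J := Num.bound `|lam N|.
have lJ k : (k < N)%N -> lam k < 2 ^+ J.
  move=> kN; apply: le_lt_trans (lam_nondecr (ltnW kN)) _.
  apply: le_lt_trans (ler_norm _) _.
  apply: lt_trans (archi_boundP (normr_ge0 _)) _.
  by rewrite -natrX ltr_nat ltn_expl.
apply: (@le_trans _ _ (\sum_(1 <= k < N) a k + \sum_(j < J)
    \sum_(1 <= k < N | in_block j k) lam k `^ (1 + beta) * a k)).
  have -> : \sum_(j < J) \sum_(1 <= k < N | in_block j k)
        lam k `^ (1 + beta) * a k =
      \sum_(1 <= k < N) \sum_(j < J | in_block j k) lam k `^ (1 + beta) * a k.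
    rewrite (eq_bigr (fun j : 'I_J => \sum_(1 <= k < N)
      if in_block j k then lam k `^ (1 + beta) * a k else 0)); last first.
      by move=> j _; rewrite big_mkcond.
    by rewrite exchange_big /=; apply: eq_bigr => k _; rewrite -big_mkcond.
  rewrite -big_split /= big_nat_cond [leRHS]big_nat_cond ler_sum// => k.
  move=> /andP[/andP[k1 kN] _].
  have t0 : 0 <= lam k `^ (1 + beta) * a k by rewrite mulr_ge0 ?powR_ge0.
  have [l1|l1] := ltP (lam k) 1.
    apply: ler_wpDr; first by apply: sumr_ge0.
    rewrite ler_piMl//.
    have := @ge0_ler_powR R (1 + beta) _ (lam k) 1; rewrite powR1; apply.
    + exact: addr_ge0.
    + by rewrite nnegrE ltW.
    + by rewrite nnegrE.
    + exact: ltW.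
  have [j jk] := in_block_ex l1 (lJ _ kN).
  by rewrite (bigD1 j)//= ler_wpDl// lerDl sumr_ge0.
apply: lerD => //.
apply: le_trans (ler_sum _ (fun (j : 'I_J) _ => block_sum_le j N)) _.
rewrite -mulr_sumr ler_wpM2l ?mulr_ge0 ?powR_ge0//.
apply: (@le_trans _ _ (omega 1 * \sum_(j < J) omega (2 ^- j))).
  rewrite mulr_sumr ler_sum// => j _.
  have p0 : 0 <= 2 ^- j :> R by rewrite invr_ge0 exprn_ge0.
  rewrite expr2 ler_wpM2r ?omega_ge0// omega_le//.
  by rewrite invf_le1 ?exprn_gt0// exprn_ege1// ler1n.
by rewrite ler_wpM2l ?omega_ge0.
Qed.

End DyadicBlocks.

(** * The theorem *)

Theorem theorem1p4 (R : realType) (H : completeNormedModType R[i])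
  (ip : {dot H for @Num.conj R[i]})
  (ip_norm : is_inner_product_of_norm ip)
  (H_separable : separable_space H)
  (A B : operator H)
  (A_sa : self_adjoint ip A) (A_pos : positive_definite ip A)
  (B_sa : self_adjoint ip B) (B_pos : positive_definite ip B)
  (domAB : dom A = dom B)
  (A_discrete : discrete_spectrum A)
  (B_discrete : discrete_spectrum B) (B_simple : simple_spectrum B)
  (lam : nat -> R) (e : nat -> H)
  (lam_spectrum : spectrum B = range (fun k => (lam k)%:C))
  (lam_increasing : forall k, lam k < lam k.+1)
  (e_basis : eigenbasis ip B lam e)
  (omega : R -> R)
  (omega_cont : {within `[0, +oo[, continuous omega})
  (omega_nondecr : {in `[0, +oo[ &, {homo omega : s t / s <= t}})
  (omega0 : omega 0 = 0)
  (omega_doubling : exists2 c' : R, 0 < c' &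
    forall t, 0 < t -> omega (2 * t) <= c' * omega t)
  (omega_dini :
    (\int[lebesgue_measure]_(t in `]0%R, 1%R]) (omega t / t)%:E < +oo)%E)
  (x y : H) (x_dom : dom B x) (x_sol : A x = y)
  (xs : nat -> H)
  (xs_ritz : forall n, (0 < n)%N -> ritz_approximation ip A y e n (xs n))
  (alpha : R) (alpha_gt1 : 1 < alpha)
  (rate : exists c : R, forall n, (0 < n)%N ->
    energy_norm ip A (x - xs n) <=
      c / (lam n `^ (alpha - 1 / 2)) * omega (1 / lam n)) :
  dom (eigen_power ip lam e alpha) x.
Proof.
have [c cP] := rate.
have A_sym := self_adjoint_symmetric A_sa.
have B_sym := self_adjoint_symmetric B_sa.
have [gA gA0 gAP] := positive_definite_rip A_pos.
have [gB gB0 gBP] := positive_definite_rip B_pos.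
have A_ge0 u : dom A u -> 0 <= rip ip (A u) u.
  by move=> Du; apply: le_trans (gAP u Du); rewrite mulr_ge0 ?sqr_ge0// ltW.
have B_ge0 u : dom B u -> 0 <= rip ip (B u) u.
  by move=> Du; apply: le_trans (gBP u Du); rewrite mulr_ge0 ?sqr_ge0// ltW.
(* The spectrum of A consists of eigenvalues, and 0 is not one of them. *)
have [A_bij [MA A_inv]] : resolvent_set A 0.
  apply: contrapT => /A_discrete[_ [u u0 [Du Au]] _].
  have := gAP u Du; rewrite Au scale0r /rip linear0l leNgt.
  by rewrite mulr_gt0// exprn_gt0// rnorm_gt0.
have A_surj w : exists u, dom A u /\ A u = w.
  by have [u [[Du Au] _]] := A_bij w; exists u; rewrite scale0r subr0 in Au.
have A_below : exists C : R, forall u, dom A u -> rnorm u <= C * rnorm (A u).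
  exists MA => u Du; have := A_inv u Du; rewrite scale0r subr0.
  by rewrite -!rnormE -rmorphM lecR.
have [e_on eB] := e_basis; have [e_orth _] := e_on.
have [M M0 BA] := relatively_bounded ip_norm A_sym B_sym domAB A_surj A_below
  (let: And3 _ d _ := B_sa in d).
have dominated := form_domination ip_norm A_sym B_sym domAB A_surj A_ge0 M0 BA.
have lam0 k : 0 < lam k.
  have [De Be] := eB k; apply: lt_le_trans gB0 _.
  have := gBP _ De; rewrite Be ripZl -(rip_rnorm ip_norm).
  by rewrite /rip e_orth eqxx /= !mulr1.
have omega_ge0 := modulus_ge0 omega_nondecr omega0.
have omega_le := modulus_le omega_nondecr.
have [C CP] := dini_dyadic_sum omega_cont omega_nondecr omega0 omega_dini.
pose a k := complex.Re `|ip x (e k)| ^+ 2.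
have a0 k : 0 <= a k by exact: sqr_ge0.
have lam_homo : {homo lam : k l / (k <= l)%N >-> k <= l}.
  by apply: homo_leq => // [p q r|k]; [exact: le_trans|exact: ltW].
have id_ge0 u : dom identity u -> 0 <= rip ip (identity u) u.
  by move=> _; rewrite (rip_rnorm ip_norm) sqr_ge0.
have id_e k : dom identity (e k) /\ identity (e k) = (1 : R)%:C *: e k.
  by rewrite scale1r.
have aS N : \sum_(1 <= k < N) a k <= rip ip x x.
  have := diagonal_form_le (mu := fun=> 1) (identity_symmetric ip) id_ge0
    e_orth id_e N (I : dom identity x).
  apply: le_trans; under [leRHS]eq_bigr do rewrite mul1r.
  rewrite -(big_mkord xpredT a).
  case: N => [|N]; first by rewrite !big_geq.
  by rewrite [leRHS]big_ltn// lerDr.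
have tail n N : (0 < n)%N -> \sum_(n <= k < N) lam k * a k <=
    M * c ^+ 2 * (omega (lam n)^-1 ^+ 2 / lam n `^ (2 * alpha - 1)).
  move=> n0; pose z := x - xs n.
  have [[coef xsE] _] := xs_ritz n n0.
  have [Dxs _] := @operator_sum _ _ _ _ B_sym _ (index_enum 'I_n)
    coef (fun k : 'I_n => e k) (fun k => (eB k).1).
  rewrite -xsE in Dxs.
  have Dz : dom B z by exact: (domB B_sym).
  have DAz : dom A z by rewrite domAB.
  have zx k : (n <= k)%N -> ip z (e k) = ip x (e k).
    move=> nk; rewrite linearBl xsE linear_sumlz big1 ?subr0// => i _.
    rewrite linearZl_LR /= e_orth.
    by rewrite (ltn_eqF (leq_trans (ltn_ord i) nk)) mulr0.
  have zBz : \sum_(n <= k < N) lam k * a k <= rip ip (B z) z.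
    apply: le_trans (diagonal_form_le B_sym B_ge0 e_orth eB N Dz).
    rewrite -(big_mkord xpredT
      (fun k => lam k * complex.Re `|ip z (e k)| ^+ 2)).
    have [nN|Nn] := leqP n N; last first.
      rewrite [leLHS]big_geq; last exact: ltnW.
      apply: sumr_ge0 => k _.
      by rewrite mulr_ge0 ?sqr_ge0// ltW.
    rewrite [leRHS](@big_cat_nat _ _ _ n)//= ler_wpDl//.
      by apply: sumr_ge0 => k _; rewrite mulr_ge0 ?sqr_ge0// ltW.
    rewrite big_nat_cond [leRHS]big_nat_cond ler_sum// => k.
    by move=> /andP[/andP[nk _] _]; rewrite zx.
  apply: le_trans zBz _; apply: le_trans (dominated _ DAz) _.
  rewrite -mulrA ler_wpM2l ?(ltW M0)//.
  have -> : rip ip (A z) z = energy_norm ip A z ^+ 2.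
    by rewrite /energy_norm sqr_sqrtr// A_ge0.
  have -> : c ^+ 2 * (omega (lam n)^-1 ^+ 2 / lam n `^ (2 * alpha - 1)) =
      (c / (lam n `^ (alpha - 1 / 2)) * omega (1 / lam n)) ^+ 2.
    have -> : lam n `^ (2 * alpha - 1) = lam n `^ (alpha - 1 / 2) ^+ 2.
      by rewrite -powR_mulrn ?powR_ge0// -powRrM; congr (_ `^ _); field.
    by rewrite (div1r (lam n)); field; rewrite gt_eqF ?powR_gt0.
  have E0 : 0 <= energy_norm ip A z := sqrtr_ge0 _.
  have rhs0 := le_trans E0 (cP n n0).
  by rewrite ler_pXn2r ?nnegrE//; exact: cP.
(* The exponents are split as 2 alpha = 1 + (2 alpha - 1), one power of lam k
   being carried by the energy. *)
have beta0 : 0 <= 2 * alpha - 1 by lra.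
have K0 : 0 <= M * c ^+ 2 by rewrite mulr_ge0 ?sqr_ge0// ltW.
have bounded := power_sum_bounded lam0 lam_homo a0 omega_ge0 omega_le
  beta0 K0 tail aS CP.
rewrite addrC subrK in bounded.
rewrite /=; pose t k := lam k `^ (2 * alpha) * a k.
have t0 k : 0 <= t k by rewrite mulr_ge0 ?powR_ge0.
apply: (@nondecreasing_is_cvgn R (series t)).
  by apply: nondecreasing_series => k _ _; exact: t0.
(* The term of index 0 is kept apart, as the rate is known from n = 1 on. *)
exists (t 0%N + (rip ip x x +
  2 `^ (2 * alpha - 1) * (M * c ^+ 2) * (omega 1 * C))) => _ [N _ <-] /=.
apply: le_trans (_ : t 0%N + \sum_(1 <= k < N) t k <= _); last first.
  by rewrite lerD2l; exact: bounded.
rewrite /series /=; case: N => [|N]; first by rewrite !big_geq// addr0.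
by rewrite big_ltn.
Qed.
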